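(* Suppose that $(G,P)=\bigoplus_{\lambda\in\Lambda}(G_\lambda,P_\lambda)$ is a direct sum of quasi-lattice ordered groups $(G_\lambda,P_\lambda)$, and let $\Omega$ and $\Omega_\lambda$, $\lambda\in\Lambda$, denote the Nica spectra of $(G,P)$ and $(G_\lambda,P_\lambda)$. Then the following are equivalent: (i) The canonical partial action of $G$ on $\Omega$ is topologically free on every closed invariant subset. (ii) For each $\lambda\in\Lambda$, the canonical partial action of $G_\lambda$ on $\Omega_\lambda$ is topologically free on every closed invariant subset.
   Context: Groups are countable. A quasi-lattice ordered group $(G,P)$ is a group $G$ with a submonoid $P$ with $P\cap P^{-1}=\{e\}$ such that, for the left-invariant partial order $x\le y\iff x^{-1}y\in P$, every two elements of $G$ having a common upper bound have a least upper bound $x\vee y$; write $x\vee y=\infty$ if there is no common upper bound. In the direct sum, $G=\bigoplus G_\lambda$ (finitely supported families) and $P=\bigoplus P_\lambda$. Nica spectrum of $(G,P)$: $\Omega$ is the set of $\omega\subset G$ with $e\in\omega$ that are hereditary ($\omega P^{-1}\subset\omega$) and directed ($x\vee y\ne\infty$ and $x\vee y\in\omega$ for $x,y\in\omega$), with the (compact Hausdorff) topology from $\{0,1\}^G$. The canonical partial action of $G$ on $\Omega$ is $\theta_t:U_{t^{-1}}\to U_t$, $\omega\mapsto t\omega$, where $U_t=\{\omega:t\in\omega\}$. $X\subset\Omega$ is invariant if $\theta_t(X\cap U_{t^{-1}})\subset X$ for all $t\in G$. The partial action is topologically free on a closed invariant $X$ if for every $t\in G\setminus\{e\}$ the fixed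 set $\{\omega\in X\cap U_{t^{-1}}:t\omega=\omega\}$ has empty interior in $X$. *)

(* Defs.v *)
From HB Require Import structures.
From mathcomp Require Import all_boot.
From mathcomp Require Import all_classical.
From mathcomp Require Import topology.

Set Implicit Arguments.
Unset Strict Implicit.
Unset Printing Implicit Defensive.

Local Open Scope classical_set_scope.
Local Open Scope group_scope.

Section ConeOrder.
Variables (G : groupType) (P : set G).

Definition cone_le (x y : G) : Prop := P (x^-1 * y).

(* [cone_lub x y z] says that [x \/ y <> oo] and [x \/ y = z]. *)
Definition cone_lub (x y z : G) : Prop :=
  [/\ cone_le x z, cone_le y z &
      forall u, cone_le x u -> cone_le y u -> cone_le z u].

End ConeOrder.

HB.mixin Record Group_isQuasiLatticeOrdered G of Group G := {
  cone : set G;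
  cone1 : cone 1;
  coneM : forall x y, cone x -> cone y -> cone (x * y);
  coneIV : cone `&` [set x | cone x^-1] = [set 1];
  cone_lub_ex : forall x y,
    (exists u, cone_le cone x u /\ cone_le cone y u) ->
    exists z, cone_lub cone x y z
}.

#[short(type="qloGroupType")]
HB.structure Definition QuasiLatticeOrdered :=
  {G of Group_isQuasiLatticeOrdered G & Group G}.

Lemma cone_lub_unique (G : qloGroupType) (x y z z' : G) :
  cone_lub cone x y z -> cone_lub cone x y z' -> z = z'.
Proof.
case=> xz yz zmin [xz' yz' zmin'].
have : [set 1] (z^-1 * z').
  rewrite -coneIV; split; first exact: zmin.
  by rewrite /= invgM invgK; apply: zmin'.
by move=> /= zz'; rewrite -[z]mulg1 -zz' mulVKg.
Qed.

Lemma cone_lub11 (G : qloGroupType) : cone_lub cone (1 : G) 1 1.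
Proof. by split; rewrite /cone_le ?mulVg; [exact: cone1|exact: cone1|]. Qed.

Record direct_sum (L : Type) (G : L -> groupType) := DirectSum {
  dsum_val :> forall l, G l;
  dsum_finite_support : finite_set [set l | dsum_val l != 1]
}.

Section DirectSumGroup.
Variables (L : Type) (G : L -> groupType).
Local Notation D := (direct_sum G).

Lemma direct_sumP (x y : D) : (forall l, x l = y l) -> x = y.
Proof.
case: x y => [x hx] [y hy] /= xy.
have {}xy : x = y by apply/functional_extensionality_dep.
by subst y; congr DirectSum; exact: Prop_irrelevance.
Qed.

HB.instance Definition _ := gen_eqMixin D.
HB.instance Definition _ := gen_choiceMixin D.

Lemma dsum_one_subproof : finite_set [set l | (1 : G l) != 1].
Proof.
apply: (@sub_finite_set _ _ set0); last exact: finite_set0.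
by move=> l /=; rewrite eqxx.
Qed.

Lemma dsum_inv_subproof (x : D) : finite_set [set l | (x l)^-1 != 1].
Proof.
apply: sub_finite_set (dsum_finite_support x) => l /=.
by apply: contraNN => /eqP ->; rewrite invg1.
Qed.

Lemma dsum_mul_subproof (x y : D) : finite_set [set l | x l * y l != 1].
Proof.
apply: (@sub_finite_set _ _ ([set l | x l != 1] `|` [set l | y l != 1])).
  move=> l /= xy1; have [x1|] := eqVneq (x l) 1; last by left.
  by right; rewrite x1 mul1g in xy1.
by rewrite finite_setU; split; exact: dsum_finite_support.
Qed.

Definition dsum_one : D := DirectSum dsum_one_subproof.
Definition dsum_inv (x : D) : D := DirectSum (dsum_inv_subproof x).
Definition dsum_mul (x y : D) : D := DirectSum (dsum_mul_subproof x y).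

Lemma dsum_mulA : associative dsum_mul.
Proof. by move=> x y z; apply: direct_sumP => l /=; rewrite mulgA. Qed.

Lemma dsum_mul1 : left_id dsum_one dsum_mul.
Proof. by move=> x; apply: direct_sumP => l /=; rewrite mul1g. Qed.

Lemma dsum_mulr1 : right_id dsum_one dsum_mul.
Proof. by move=> x; apply: direct_sumP => l /=; rewrite mulg1. Qed.

Lemma dsum_mulV : left_inverse dsum_one dsum_inv dsum_mul.
Proof. by move=> x; apply: direct_sumP => l /=; rewrite mulVg. Qed.

Lemma dsum_mulrV : right_inverse dsum_one dsum_inv dsum_mul.
Proof. by move=> x; apply: direct_sumP => l /=; rewrite mulgV. Qed.

HB.instance Definition _ := isGroup.Build D
  dsum_mulA dsum_mul1 dsum_mulr1 dsum_mulV dsum_mulrV.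

End DirectSumGroup.

Section DirectSumCone.
Variables (L : Type) (G : L -> qloGroupType).
Local Notation D := (direct_sum G).

Definition dsum_cone : set D := [set x | forall l, cone (x l)].

Lemma dsum_cone1 : dsum_cone 1.
Proof. by move=> l; exact: cone1. Qed.

Lemma dsum_coneM (x y : D) : dsum_cone x -> dsum_cone y -> dsum_cone (x * y).
Proof. by move=> Px Py l; apply: coneM. Qed.

Lemma dsum_coneIV : dsum_cone `&` [set x | dsum_cone x^-1] = [set 1].
Proof.
apply/seteqP; split=> [x [Px PVx]|_ ->] /=.
  apply: direct_sumP => l.
  have : [set 1] (x l) by rewrite -coneIV; split; [exact: Px|exact: PVx].
  by [].
by split; rewrite /= ?invg1; exact: dsum_cone1.
Qed.

Lemma dsum_cone_lub_ex (x y : D) :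
  (exists u, cone_le dsum_cone x u /\ cone_le dsum_cone y u) ->
  exists z, cone_lub dsum_cone x y z.
Proof.
case=> u [xu yu].
have ex_lub l : exists z, cone_lub cone (x l) (y l) z.
  by apply: cone_lub_ex; exists (u l); split; [exact: xu|exact: yu].
pose z l := sval (cid (ex_lub l)).
have zP l : cone_lub cone (x l) (y l) (z l) := svalP (cid (ex_lub l)).
have zfin : finite_set [set l | z l != 1].
  apply: (@sub_finite_set _ _ ([set l | x l != 1] `|` [set l | y l != 1])).
    move=> l /= z1; have [x1|] := eqVneq (x l) 1; last by left.
    have [y1|] := eqVneq (y l) 1; last by right.
    case/eqP: z1; apply: cone_lub_unique (cone_lub11 (G l)).
    by have := zP l; rewrite x1 y1.
  by rewrite finite_setU; split; exact: dsum_finite_support.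
exists (DirectSum zfin); split=> [l|l|v xv yv l] /=.
- by case: (zP l).
- by case: (zP l).
- by case: (zP l) => _ _; apply; [exact: xv|exact: yv].
Qed.

HB.instance Definition _ := Group_isQuasiLatticeOrdered.Build D
  dsum_cone1 dsum_coneM dsum_coneIV dsum_cone_lub_ex.

End DirectSumCone.

(* Subsets of [G] are identified with their indicator functions [G -> bool]. *)
Definition nica_sets (G : qloGroupType) : set {ptws G -> bool} :=
  [set w : {ptws G -> bool} | [/\ w 1,
     (forall x p, w x -> cone p -> w (x * p^-1)) &
     (forall x y, w x -> w y -> exists2 z, cone_lub cone x y z & w z)]].

(* A [set_type] carries the topology induced from the ambient space. *)
Definition nica_spectrum (G : qloGroupType) : Type :=
  set_type (@nica_sets G).

HB.instance Definition _ (G : qloGroupType) :=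
  Topological.copy (nica_spectrum G) (set_type (@nica_sets G)).

Section PartialAction.
Variable G : qloGroupType.
Local Notation Omega := (nica_spectrum G).

Definition nica_dom (t : G) : set Omega := [set w : Omega | set_val w t].

(* The indicator function of [t w]. *)
Definition translate (t : G) (w : {ptws G -> bool}) : {ptws G -> bool} :=
  fun x => w (t^-1 * x).

Lemma translate_nica (t : G) (w : {ptws G -> bool}) :
  nica_sets w -> w t^-1 -> nica_sets (translate t w).
Proof.
rewrite /translate; case=> w1 wh wd wt; split.
- by rewrite mulg1.
- by move=> x p wx Pp; rewrite mulgA; apply: wh.
- move=> x y wx wy; have [z [xz yz zmin] wz] := wd _ _ wx wy.
  have leM a b : cone_le cone (t^-1 * a) b <-> cone_le cone a (t * b).
    by rewrite /cone_le invgM invgK mulgA.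
  exists (t * z); last by rewrite mulKg.
  split; [exact/leM|exact/leM|move=> u xu yu].
  rewrite /cone_le invgM -mulgA.
  by apply: zmin; apply/leM; rewrite mulVKg.
Qed.

Lemma nica_action_subproof1 (t : G) (w : nica_dom t^-1) :
  translate t (set_val (set_val w)) \in @nica_sets G.
Proof.
by apply/mem_set/translate_nica; [exact: set_valP|exact: (set_valP w)].
Qed.

Definition nica_translate (t : G) (w : nica_dom t^-1) : Omega :=
  @exist _ (fun v => v \in @nica_sets G) _ (nica_action_subproof1 w).

Lemma nica_action_subproof2 (t : G) (w : nica_dom t^-1) :
  nica_translate w \in nica_dom t.
Proof.
apply/mem_set; change (set_val (set_val w) (t^-1 * t)); rewrite mulVg.
by have [] := set_valP (set_val w).
Qed.

Definition nica_action (t : G) (w : nica_dom t^-1) : nica_dom t :=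
  @exist _ (fun v => v \in nica_dom t) _ (nica_action_subproof2 w).

Definition invariant (X : set Omega) : Prop :=
  forall (t : G) (w : nica_dom t^-1),
    X (set_val w) -> X (set_val (nica_action w)).

Definition fixed_set (X : set Omega) (t : G) : set Omega :=
  [set set_val w | w in [set w : nica_dom t^-1 |
                       X (set_val w) /\ set_val (nica_action w) = set_val w]].

(* [fixed_set X t] is contained in [X], so its interior in [subspace X] is its
   interior relative to [X]. *)
Definition topologically_free_on (X : set Omega) : Prop :=
  forall t : G, t <> 1 -> (fixed_set X t : set (subspace X))° = set0.

Definition topologically_free_on_closed_invariant : Prop :=
  forall X : set Omega,
    closed X -> invariant X -> topologically_free_on X.

End PartialAction.

(* Main.v *)
(* The Nica spectrum of the direct sum is the product of the spectra of the
   summands: [w] is recovered from its part [coord l w] in [G l] and from the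
   other coordinates, and [set_coord w l s] replaces the [l]-th part by [s].
   Both maps are continuous and equivariant, so they pull closed invariant sets
   back to closed invariant sets.  If [t l] fixes a nonempty relatively open
   part of [X] in the [l]-th spectrum, then [t l], placed at [l], fixes a
   nonempty relatively open part of the preimage of [X] under [coord l].
   Conversely, if [t] fixes a relatively open part of [X] containing [w] and
   [t l <> 1], then [t l] fixes a relatively open part, containing [coord l w],
   of the preimage of [X] under [set_coord w l]. *)
Require Import Defs.
From HB Require Import structures.
From mathcomp Require Import all_boot.
From mathcomp Require Import all_classical.
From mathcomp Require Import topology.

Set Implicit Arguments.
Unset Strict Implicit.
Unset Printing Implicit Defensive.

Local Open Scope classical_set_scope.
Local Open Scope group_scope.

(** * The partial action and the topology of a single Nica spectrum *)

Section Spectrum.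
Variable G : qloGroupType.
Implicit Types (w v : nica_spectrum G) (X : set (nica_spectrum G)).

Definition spectrum_of (w : {ptws G -> bool}) (hw : nica_sets w) :
  nica_spectrum G := exist (fun u => u \in @nica_sets G) w (mem_set hw).

Lemma spectrum_inj w v : (forall x, set_val w x = set_val v x) -> w = v.
Proof. by move=> wv; apply: val_inj; apply/funext. Qed.

Lemma spectrum1 w : set_val w 1.
Proof. by have [] := set_valP w. Qed.

Lemma spectrum_le w (x y : G) : cone_le cone x y -> set_val w y -> set_val w x.
Proof.
move=> xy wy; have [_ wh _] := set_valP w.
by have := wh _ _ wy xy; rewrite invgM invgK mulVKg.
Qed.

Lemma spectrum_lub w (x y : G) : set_val w x -> set_val w y ->
  exists2 z, cone_lub cone x y z & set_val w z.
Proof. by have [_ _] := set_valP w; apply. Qed.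

(** The total map [translate] is used here instead of the partial action; the domain condition
    follows, by [fixes_dom]. *)
Definition fixes (t : G) w := translate t (set_val w) = set_val w.

Lemma fixes_dom (t : G) w : fixes t w -> set_val w t^-1.
Proof. by move=> tw; rewrite -[t^-1]mulg1 -/(translate t _ 1) tw spectrum1. Qed.

(** Trades the subtype [nica_dom t^-1] for a membership hypothesis and an equation between indicator
    functions. *)
Lemma invariantP X : Defs.invariant X <->
  forall t w v, set_val w t^-1 -> set_val v = translate t (set_val w) ->
    X w -> X v.
Proof.
split=> [Xinv t w v wt vE Xw|Xinv t w Xw]; last first.
  by apply: (Xinv t (set_val w)) => //; exact: (set_valP w).
pose w' : nica_dom t^-1 := exist (fun v => v \in nica_dom t^-1) w (mem_set wt).
suff -> : v = set_val (nica_action w') by exact: Xinv.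
by apply: spectrum_inj => x; rewrite vE.
Qed.

Lemma fixed_setE X (t : G) :
  fixed_set X t = [set w | X w /\ fixes t w].
Proof.
apply/seteqP; split=> [_ [w [Xw tw] <-]|w [Xw tw]] /=.
  by split=> //; rewrite /fixes -[in RHS]tw.
pose w' : nica_dom t^-1 :=
  exist (fun v => v \in nica_dom t^-1) w (mem_set (fixes_dom tw)).
by exists w' => //; split=> //; apply: spectrum_inj => x; rewrite -[in RHS]tw.
Qed.

Lemma topologically_free_onP X : topologically_free_on X <->
  forall (t : G) w (U : set (nica_spectrum G)), open U -> U w -> X w ->
    U `&` X `<=` [set v | fixes t v] -> t = 1.
Proof.
split=> [Xfree t w U oU Uw Xw UX|Xfree t t1].
  apply: contrapT => /Xfree F0.
  suff : (fixed_set X t : set (subspace X))° w by rewrite F0.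
  (* At a point of [X], neighbourhoods in [subspace X] are those of the spectrum filtered [within]
     [X]. *)
  rewrite fixed_setE /interior /= -[nbhs _]/(nbhs_subspace _).
  rewrite -nbhs_subspace_in//.
  rewrite /within /= nbhsE /=; exists U; first by split.
  by move=> v Uv Xv; split=> //; exact: UX.
rewrite -subset0 fixed_setE => w Fw.
have [Xw tw] : [set w | X w /\ fixes t w] w := interior_subset Fw.
move: Fw; rewrite /interior /= -[nbhs _]/(nbhs_subspace _) -nbhs_subspace_in//.
rewrite /within /= nbhsE => -[U [oU Uw] UX]; apply: t1.
by apply: (Xfree t w U) => // v [Uv Xv]; have [] := UX v Uv Xv.
Qed.

Lemma eval_continuous (x : G) : continuous (fun w => set_val w x : bool).
Proof.
pose f : nica_spectrum G -> {ptws G -> bool} := set_val.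
have fc : continuous f by exact: initial_continuous.
move=> w.
have : (proj x \o f) @ w --> f w x by apply: continuous_comp;
  [exact: fc|exact: (@proj_continuous G (fun=> bool))].
by [].
Qed.

(** The topology is induced from a product, itself the supremum of the topologies induced by the
    evaluations. *)
Lemma spectrum_continuous (T : topologicalType) (f : T -> nica_spectrum G) :
  (forall x, continuous (fun s => set_val (f s) x : bool)) -> continuous f.
Proof.
move=> fc; apply: continuous_comp_initial => s.
apply/cvg_sup => x.
exact: (@continuous_comp_initial _ _ _ (fun w : G -> bool => w x)
  (fun s => set_val (f s)) (fc x) s).
Qed.

(** This is the least point of the spectrum, which is therefore nonempty. It is directed because [1]
    bounds all its elements from above. *)
Lemma nica_setsVcone : nica_sets (fun x : G => `[< cone x^-1 >]).
Proof.
split=> [|x p /asboolP Px Pp|x y /asboolP Px /asboolP Py].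
- by apply/asboolP; rewrite invg1; exact: cone1.
- by apply/asboolP; rewrite invgM invgK; exact: coneM.
- have [|z [xz yz zmin]] := @cone_lub_ex G x y.
    by exists 1; rewrite /cone_le !mulg1.
  exists z => //; apply/asboolP; rewrite -[z^-1]mulg1.
  by apply: zmin; rewrite /cone_le mulg1.
Qed.

End Spectrum.

(** * Replacing one component of a family, and the coordinate maps this induces on spectra *)

Section DirectSum.
Variables (L : Type) (G : L -> qloGroupType).
Local Notation D := (direct_sum G).
Implicit Types (x y z : D) (l : L) (w : nica_spectrum (direct_sum G)).

(** The index type is arbitrary, so [l = m] is decided classically and [a] is transported along the
    resulting proof. *)
Definition upd_fun x l (a : G l) (m : L) : G m :=
  match pselect (l = m) with
  | left lm => ecast m (G m) lm a
  | right _ => x m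
  end.

Lemma upd_fun_same x l (a : G l) : upd_fun x a l = a.
Proof.
rewrite /upd_fun; case: pselect => // ll.
by rewrite (Prop_irrelevance ll (erefl l)).
Qed.

Lemma upd_fun_other x l (a : G l) m : l <> m -> upd_fun x a m = x m.
Proof. by rewrite /upd_fun; case: pselect. Qed.

Lemma upd_finite_support x l (a : G l) :
  finite_set [set m | upd_fun x a m != 1].
Proof.
apply: (@sub_finite_set _ _ ([set m | x m != 1] `|` [set l])).
  move=> m /=; have [lm|lm] := pselect (l = m); first by right.
  by rewrite upd_fun_other //; left.
by rewrite finite_setU; split; [exact: dsum_finite_support|exact: finite_set1].
Qed.

Definition upd x l (a : G l) : D := DirectSum (upd_finite_support x a).

Lemma upd_same x l (a : G l) : upd x a l = a.
Proof. exact: upd_fun_same. Qed.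

Lemma upd_other x l (a : G l) m : l <> m -> upd x a m = x m.
Proof. exact: upd_fun_other. Qed.

Lemma dsumM x y m : (x * y) m = x m * y m. Proof. by []. Qed.
Lemma dsumV x m : x^-1 m = (x m)^-1. Proof. by []. Qed.

Lemma updM x y l (a b : G l) : upd x a * upd y b = upd (x * y) (a * b).
Proof.
apply: direct_sumP => m; rewrite dsumM.
have [<-|lm] := pselect (l = m); first by rewrite !upd_same.
by rewrite !upd_other.
Qed.

Lemma updV x l (a : G l) : (upd x a)^-1 = upd x^-1 a^-1.
Proof.
apply: direct_sumP => m; rewrite dsumV.
have [<-|lm] := pselect (l = m); first by rewrite !upd_same.
by rewrite !upd_other.
Qed.

Lemma upd_id x l : upd x (x l) = x.
Proof.
apply: direct_sumP => m.
have [<-|lm] := pselect (l = m); first by rewrite !upd_same.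
by rewrite !upd_other.
Qed.

Lemma upd_upd x l (a b : G l) : upd (upd x a) b = upd x b.
Proof.
apply: direct_sumP => m.
have [<-|lm] := pselect (l = m); first by rewrite !upd_same.
by rewrite !upd_other.
Qed.

Lemma upd1 l : upd 1 (1 : G l) = 1.
Proof. exact: upd_id. Qed.

Lemma upd_le x y l (a b : G l) :
  cone_le cone a b -> (forall m, l <> m -> cone_le cone (x m) (y m)) ->
  cone_le cone (upd x a) (upd y b).
Proof.
move=> ab xy m; rewrite dsumM dsumV.
have [<-|lm] := pselect (l = m); first by rewrite !upd_same.
by rewrite !upd_other //; exact: xy.
Qed.

Lemma dsum_le x y : cone_le cone x y -> forall m, cone_le cone (x m) (y m).
Proof. by []. Qed.

Lemma cone_le_refl (H : qloGroupType) (a : H) : cone_le cone a a.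
Proof. by rewrite /cone_le mulVg; exact: cone1. Qed.

(* Joining [x] with [1] yields an upper bound that dominates both of its
   truncations; conversely [x] lies below the join of its truncations. *)
Lemma spectrum_split l w x :
  set_val w x = set_val w (upd 1 (x l)) && set_val w (upd x (1 : G l)).
Proof.
apply/idP/andP => [wx|[wl wx]].
  have [z [xz z1 _] wz] := spectrum_lub wx (spectrum1 w).
  split; apply: spectrum_le wz; rewrite -(upd_id z l); apply: upd_le.
  - exact: dsum_le.
  - by move=> m _; exact: (dsum_le z1).
  - exact: (dsum_le z1).
  - by move=> m _; exact: dsum_le.
have [z [lz xz _] wz] := spectrum_lub wl wx.
apply: spectrum_le wz; rewrite -(upd_id x l) -(upd_id z l); apply: upd_le.
  by have := dsum_le lz l; rewrite upd_same.
by move=> m lm; have := dsum_le xz m; rewrite upd_other.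
Qed.

Lemma coord_nica l w : nica_sets (fun a : G l => set_val w (upd 1 a)).
Proof.
split=> [|a p wa Pp|a b wa wb]; first by rewrite upd1 spectrum1.
  apply: spectrum_le wa; apply: upd_le => [|m _]; last exact: cone_le_refl.
  by rewrite /cone_le invgM invgK mulgVK.
have [z [az bz zmin] wz] := spectrum_lub wa wb.
exists (z l); last first.
  (* Away from [l], [z] dominates [1], so [upd 1 (z l)] lies below [z]. *)
  apply: spectrum_le wz; rewrite -[X in cone_le _ _ X](upd_id z l).
  apply: upd_le; first exact: cone_le_refl.
  by move=> m lm; have := dsum_le az m; rewrite upd_other.
split=> [||u au bu].
- by have := dsum_le az l; rewrite upd_same.
- by have := dsum_le bz l; rewrite upd_same.
- suff /dsum_le/(_ l) : cone_le cone z (upd 1 u) by rewrite upd_same.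
  by apply: zmin; apply: upd_le => // m _; exact: cone_le_refl.
Qed.

Definition coord l w : nica_spectrum (G l) := spectrum_of (coord_nica l w).

(** The formula is the factorization in [spectrum_split] with its first factor replaced by [s]. *)
Lemma set_coord_nica w l (s : nica_spectrum (G l)) :
  nica_sets (fun x : D => set_val s (x l) && set_val w (upd x (1 : G l))).
Proof.
split=> [|x p /andP[sx wx] Pp|x y /andP[sx wx] /andP[sy wy]].
- by rewrite upd1 !spectrum1.
- apply/andP; split.
    apply: spectrum_le sx; rewrite /cone_le dsumM dsumV invgM invgK mulgVK.
    exact: Pp.
  apply: spectrum_le wx; apply: upd_le => [|m _]; first exact: cone_le_refl.
  by rewrite /cone_le dsumM dsumV invgM invgK mulgVK; exact: Pp.
- have [a [xa ya amin] sa] := spectrum_lub sx sy.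
  have [z [xz yz zmin] wz] := spectrum_lub wx wy.
  (* The join is taken in [s] at [l], and in [w], between truncations, elsewhere. *)
  exists (upd z a); last first.
    apply/andP; split; first by rewrite upd_same.
    apply: spectrum_le wz; rewrite upd_upd -[X in cone_le _ _ X](upd_id z l).
    apply: upd_le => [|m _]; last exact: cone_le_refl.
    by have := dsum_le xz l; rewrite upd_same.
  split=> [||u xu yu].
  + rewrite -[X in cone_le _ X](upd_id x l); apply: upd_le => // m lm.
    by have := dsum_le xz m; rewrite upd_other.
  + rewrite -[X in cone_le _ X](upd_id y l); apply: upd_le => // m lm.
    by have := dsum_le yz m; rewrite upd_other.
  + rewrite -[X in cone_le _ _ X](upd_id u l); apply: upd_le.
      by apply: amin; exact: dsum_le.
    (* Truncating [u] at [l] keeps it above both truncations, hence above their join [z]. *)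
    have /dsum_le zu : cone_le cone z (upd u (1 : G l)).
      by apply: zmin; apply: upd_le => [|m _];
        [exact: cone_le_refl|exact: dsum_le|exact: cone_le_refl|exact: dsum_le].
    by move=> m lm; have := zu m; rewrite upd_other.
Qed.

Definition set_coord w l (s : nica_spectrum (G l)) : nica_spectrum D :=
  spectrum_of (set_coord_nica w s).

Lemma coord_continuous l : continuous (coord l).
Proof. by apply: spectrum_continuous => a; exact: eval_continuous. Qed.

Lemma set_coord_continuous w l : continuous (@set_coord w l).
Proof.
apply: spectrum_continuous => x.
change (continuous (fun s : nica_spectrum (G l) =>
  set_val s (x l) && set_val w (upd x (1 : G l)))).
(* The second factor does not depend on [s], so the map is an evaluation or constantly [false]. *)
case: (set_val w (upd _ _)).
  by under eq_fun do rewrite andbT; exact: eval_continuous.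
by under eq_fun do rewrite andbF; exact: cst_continuous.
Qed.

Lemma coordK l w : set_coord w (coord l w) = w.
Proof. by apply: spectrum_inj => x; rewrite [RHS](spectrum_split l). Qed.

Lemma set_coordK w l (s : nica_spectrum (G l)) : coord l (set_coord w s) = s.
Proof.
apply: spectrum_inj => a /=.
change (set_val s (upd 1 a l) && set_val w (upd (upd 1 a) (1 : G l))
  = set_val s a).
by rewrite upd_same upd_upd upd1 spectrum1 andbT.
Qed.

Lemma coord_translate l (t : D) w v : set_val w t^-1 ->
  set_val v = translate t (set_val w) ->
  set_val (coord l v) = translate (t l) (set_val (coord l w)).
Proof.
move=> wt vE; apply/funext => a.
change (set_val v (upd 1 a) = set_val w (upd 1 ((t l)^-1 * a))).
rewrite vE /translate (spectrum_split l) dsumM dsumV upd_same.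
(* Away from [l] the argument agrees with [t^-1], so the domain condition [wt] makes the second
   factor [true]. *)
suff -> : upd (t^-1 * upd 1 a) (1 : G l) = upd t^-1 (1 : G l).
  by move: wt; rewrite (spectrum_split l) => /andP[_ ->]; rewrite andbT.
by rewrite -[t^-1](upd_id _ l) updM !upd_upd mulg1.
Qed.

(** Since [upd 1 t] is trivial away from [l], it leaves the factor coming from [w] unchanged. *)
Lemma set_coord_translate w l (t : G l) (s r : nica_spectrum (G l)) :
  set_val r = translate t (set_val s) ->
  set_val (set_coord w r) = translate (upd 1 t) (set_val (set_coord w s)).
Proof.
move=> rE; apply/funext => x.
change (set_val r (x l) && set_val w (upd x (1 : G l)) =
  set_val s (((upd 1 t)^-1 * x) l) &&
  set_val w (upd ((upd 1 t)^-1 * x) (1 : G l))).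
rewrite rE /translate dsumM dsumV upd_same updV; congr (_ && set_val w _).
by rewrite -{2}[x](upd_id x l) updM upd_upd invg1 mul1g.
Qed.

Lemma coord_preimage_invariant l (X : set (nica_spectrum (G l))) :
  Defs.invariant X -> Defs.invariant (coord l @^-1` X).
Proof.
move=> /invariantP Xinv; apply/invariantP => t w v wt vE.
apply: (Xinv (t l)); last exact: coord_translate.
by move: wt; rewrite (spectrum_split l) => /andP[].
Qed.

Lemma set_coord_preimage_invariant w l (X : set (nica_spectrum D)) :
  Defs.invariant X -> Defs.invariant (@set_coord w l @^-1` X).
Proof.
move=> /invariantP Xinv; apply/invariantP => t s r st rE.
apply: (Xinv (upd 1 t)); last exact: set_coord_translate.
change (set_val s ((upd 1 t)^-1 l) &&
  set_val w (upd (upd 1 t)^-1 (1 : G l))).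
by rewrite dsumV upd_same updV upd_upd invg1 upd1 st spectrum1.
Qed.

Lemma fixes_coord l (t : D) w : fixes t w -> fixes (t l) (coord l w).
Proof.
move=> tw; rewrite /fixes -(@coord_translate l t w w) //; exact: fixes_dom.
Qed.

Lemma coord_fixes l (t : G l) w : fixes t (coord l w) -> fixes (upd 1 t) w.
Proof.
move=> tw; rewrite /fixes -[w](coordK l).
by rewrite -(set_coord_translate w (esym tw)).
Qed.

(** * Transfer of topological freeness in both directions *)

Lemma dsum_free_coord l : topologically_free_on_closed_invariant D ->
  topologically_free_on_closed_invariant (G l).
Proof.
move=> Dfree X Xcl Xinv; apply/topologically_free_onP => t s U oU Us Xs UX.
have /topologically_free_onP Xfree : topologically_free_on (coord l @^-1` X).
  apply: Dfree; last exact: coord_preimage_invariant.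
  by move: X Xcl {Xinv Xs UX}; apply/continuous_closedP/coord_continuous.
(* Any base point would do: it only serves to lift [s] to a point of both preimages. *)
pose w := set_coord (spectrum_of (@nica_setsVcone D)) s.
have /Xfree/(_ _ _ _) : open (coord l @^-1` U).
  by move: U oU {Us UX}; apply/continuousP/coord_continuous.
move=> /(_ (upd 1 t) w); rewrite /= set_coordK => /(_ Us Xs) t1.
rewrite -[t](@upd_same 1 l) t1 // => v [Uv Xv].
by apply: coord_fixes; apply: UX.
Qed.

Lemma coord_free_dsum :
  (forall l, topologically_free_on_closed_invariant (G l)) ->
  topologically_free_on_closed_invariant D.
Proof.
move=> Gfree X Xcl Xinv; apply/topologically_free_onP => t w U oU Uw Xw UX.
apply: direct_sumP => l.
have /topologically_free_onP Xfree :
    topologically_free_on (@set_coord w l @^-1` X).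
  apply: Gfree; last exact: set_coord_preimage_invariant.
  by move: X Xcl {Xinv Xw UX}; apply/continuous_closedP/set_coord_continuous.
apply: (Xfree _ (coord l w) (@set_coord w l @^-1` U)).
- by move: U oU {Uw UX}; apply/continuousP/set_coord_continuous.
- by rewrite /= coordK.
- by rewrite /= coordK.
(* The point [set_coord w s] lies in [U] and [X], so [t] fixes it, and [s] is its [l]-th part. *)
- move=> s [Us Xs]; rewrite /= -[s](set_coordK w).
  by apply: fixes_coord; apply: UX.
Qed.

End DirectSum.

Theorem proposition7p4 (L : Type) (G : L -> qloGroupType)
    (countable_G : forall l : L, countable [set: G l]%classic)
    (countable_sum : countable [set: direct_sum G]%classic) :
  topologically_free_on_closed_invariant (direct_sum G) <->
  (forall l : L, topologically_free_on_closed_invariant (G l)).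
Proof.
split=> [Dfree l|]; first exact: dsum_free_coord.
exact: coord_free_dsum.
Qed.
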